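(* Let $W=e_1\otimes e_0\otimes e_0+e_0\otimes e_1\otimes e_0+e_0\otimes e_0\otimes e_1\in\mathbb{C}^2\otimes\mathbb{C}^2\otimes\mathbb{C}^2$, where $e_0,e_1$ is the standard basis of $\mathbb{C}^2$. The tensor rank of the tensor cube $W^{\otimes 3}\in\mathbb{C}^{8}\otimes\mathbb{C}^{8}\otimes\mathbb{C}^{8}$ equals $16$.
   Context: For finite-dimensional complex vector spaces $V_1,V_2,V_3$, the tensor rank of $t\in V_1\otimes V_2\otimes V_3$ is the smallest number $r$ such that $t$ is a sum of $r$ simple tensors, i.e. tensors of the form $v_1\otimes v_2\otimes v_3$ with $v_i\in V_i$. The tensor cube $W^{\otimes 3}$ is the $3$-fold tensor Kronecker product of $W$: the tensor Kronecker product of $s\in U_1\otimes U_2\otimes U_3$ and $t\in V_1\otimes V_2\otimes V_3$ is $s\otimes t$ regarded as a $3$-tensor in $(U_1\otimes V_1)\otimes(U_2\otimes V_2)\otimes(U_3\otimes V_3)$. Thus $W^{\otimes 3}$ is regarded as a $3$-tensor in $((\mathbb{C}^2)^{\otimes 3})\otimes((\mathbb{C}^2)^{\otimes 3})\otimes((\mathbb{C}^2)^{\otimes 3})$, with $(\mathbb{C}^2)^{\otimes 3}\cong\mathbb{C}^8$, and its tensor rank is with respect to this $3$-tensor structure. *)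

(* Defs.v *)
From mathcomp Require Import all_boot all_order all_algebra.
From mathcomp Require Import boolp.

Set Implicit Arguments.
Unset Strict Implicit.
Unset Printing Implicit Defensive.

Import GRing.Theory.
Local Open Scope ring_scope.

(* {ffun I -> F} is the coordinate space F^I and {ffun I * J * K -> F} is
   F^I (x) F^J (x) F^K, by coordinates in the basis e_i (x) e_j (x) e_k. *)
Notation tensor3 F I J K := {ffun I * J * K -> F} (only parsing).

Definition tensor_prod (F : fieldType) (I J K : finType)
    (u : {ffun I -> F}) (v : {ffun J -> F}) (w : {ffun K -> F}) :
    tensor3 F I J K :=
  [ffun x => u x.1.1 * v x.1.2 * w x.2].

Definition is_simple (F : fieldType) (I J K : finType)
    (t : tensor3 F I J K) : Prop :=
  exists (u : {ffun I -> F}) (v : {ffun J -> F}) (w : {ffun K -> F}),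
    t = tensor_prod u v w.

Definition sum_of_simples (F : fieldType) (I J K : finType)
    (t : tensor3 F I J K) (r : nat) : Prop :=
  exists s : 'I_r -> tensor3 F I J K,
    (forall l, is_simple (s l)) /\ t = \sum_(l < r) s l.

Definition basis_vec (F : fieldType) (I : finType) (i : I) : {ffun I -> F} :=
  [ffun j => (j == i)%:R].

Lemma sum_of_simples_exists (F : fieldType) (I J K : finType)
    (t : tensor3 F I J K) : exists r, `[< sum_of_simples t r >].
Proof.
exists #|{: I * J * K}|; apply/asboolP.
pose s (x : I * J * K) : tensor3 F I J K :=
  tensor_prod (t x *: (basis_vec F x.1.1 : {ffun I -> F^o}))
    (basis_vec F x.1.2) (basis_vec F x.2).
exists (fun l => s (enum_val l)); split.
  by move=> l; do 3!eexists; reflexivity.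
apply/ffunP => y; rewrite sum_ffunE -(big_enum_val (A := {: I * J * K}) (fun x => s x y)) /=.
rewrite (bigD1 y) //= big1 ?addr0 => [|x neq_xy].
  by rewrite !ffunE !eqxx /= /GRing.scale /= !mulr1.
rewrite !ffunE /GRing.scale /=.
case: eqP => [e1|_]; last by rewrite mulr0 !mul0r.
case: eqP => [e2|_]; last by rewrite mulr0 mul0r.
case: eqP => [e3|_]; last by rewrite mulr0.
by case/eqP: neq_xy; case: x y e1 e2 e3 => [[? ?] ?] [[? ?] ?] /= -> -> ->.
Qed.

Definition tensor_rank (F : fieldType) (I J K : finType)
    (t : tensor3 F I J K) : nat :=
  ex_minn (sum_of_simples_exists t).

(* F^I1 (x) F^I2 is identified with F^(I1 * I2) by taking e_i1 (x) e_i2 to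
   e_(i1, i2), and similarly for the J and K factors. *)
Definition tensor_kron (F : fieldType) (I1 J1 K1 I2 J2 K2 : finType)
    (s : tensor3 F I1 J1 K1) (t : tensor3 F I2 J2 K2) :
    tensor3 F (I1 * I2)%type (J1 * J2)%type (K1 * K2)%type :=
  [ffun x => s (x.1.1.1, x.1.2.1, x.2.1) * t (x.1.1.2, x.1.2.2, x.2.2)].

Definition tensor_cube (F : fieldType) (I J K : finType)
    (t : tensor3 F I J K) :
    tensor3 F (I * I * I)%type (J * J * J)%type (K * K * K)%type :=
  tensor_kron (tensor_kron t t) t.

Definition W_tensor (F : fieldType) : tensor3 F 'I_2 'I_2 'I_2 :=
  let e0 := basis_vec F (0 : 'I_2) in
  let e1 := basis_vec F (1 : 'I_2) in
  tensor_prod e1 e0 e0 + tensor_prod e0 e1 e0 + tensor_prod e0 e0 e1.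

(* Main.v *)
(* W^(x)3 is the structure tensor of the local algebra
   A = F[x, y, z] / (x^2, y^2, z^2), whose maximal ideal m has dimension 7 and
   satisfies m^4 = 0.

   Lower bound. Suppose ab = sum_l u_l(a) v_l(b) w_l with 15 terms. Seven of the
   u_l restrict to a basis of m^*; they vanish at some unit a = 1 + x0, x0 in m,
   so multiplication by a is the sum of the other 8 rank one maps, whose v_l
   and w_l are then bases of A^* and A. If x_1, ..., x_7 is the basis of m dual
   to the seven u_l, then a^-1 x_i acts as a diagonalizable map plus a map of
   rank one. Since it is nilpotent of order 4, its rank is at most 3. But an
   element of m with a nonzero coefficient on a generator acts with rank at
   least 4, and some x_i is such an element.

   Upper bound. Let tau_0, ..., tau_3 be distinct with sum s <> 0, let
   Q = prod_i (X - tau_i), and let eps run over the sign vectors with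
   eps_1 eps_2 eps_3 = 1. In the cubes of the 16 forms
     (tau_i^2 - s tau_i + h) a_0 + sum_j eps_j (tau_i a_j + b_j) - c / s,
   weighted by 1 / (4 Q'(tau_i)), the sum over i computes divided differences at
   the tau_i, and for a suitable h the total is
     3 a_0^2 c + 6 a_0 sum_j a_j b_j + 6 a_1 a_2 a_3,
   the cubic form of W^(x)3 (with a_0, a_j, b_j, c dual to 1, to the generators,
   to the products of two generators, and to xyz). The values tau = 0, 1, 3, -3
   give s = 1 and h = -6. *)
Require Import Defs.
From mathcomp Require Import all_boot all_order all_algebra.
From mathcomp Require Import reals complex.
From mathcomp Require Import boolp ring.

Set Implicit Arguments.
Unset Strict Implicit.
Unset Printing Implicit Defensive.

Import GRing.Theory Num.Theory.
Local Open Scope ring_scope.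

(** * Rank-one perturbations and filtered matrices *)

(* D and L agree modulo the span K of the v L^i, so D^(k+1) has its rows in K,
   hence so do D (which is E D^(k+1)) and L. If L had rank k + 1, its row space
   would be K, so that v = y L for some y and v L^k = y L^(k+1) = 0, making K too
   small. The hypothesis on E holds for every diagonalizable D. *)
Lemma rank_perturbation (F : fieldType) (n k : nat) (L D E : 'M[F]_n.+1)
    (w : 'cV[F]_n.+1) (v : 'rV[F]_n.+1) :
  L = D + w *m v -> L ^+ k.+1 = 0 -> D = E *m D ^+ k.+1 -> (\rank L <= k)%N.
Proof.
move=> defL nilL semiD.
pose K : 'M_(k.+1, n.+1) := \matrix_(i < k.+1) (v *m L ^+ i).
have vK i : (v *m L ^+ i <= K)%MS.
  have [lt_ik | le_ki] := ltnP i k.+1.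
    by rewrite -[v *m _](rowK (fun i : 'I_k.+1 => v *m L ^+ i) (Ordinal lt_ik)) row_sub.
  by rewrite -(subnK le_ki) exprD nilL mulr0 mulmx0 sub0mx.
have v_sub_K : (v <= K)%MS by rewrite -[v]mulmx1; exact: vK 0.
have KL : (K *m L <= K)%MS.
  by apply/row_subP => i; rewrite row_mul rowK -mulmxA mulmxE -exprSr vK.
have DK i : (D ^+ i - L ^+ i <= K)%MS.
  elim: i => [|i IHi]; first by rewrite subrr sub0mx.
  have -> : D ^+ i.+1 - L ^+ i.+1 = (D ^+ i - L ^+ i) *m L - (D ^+ i *m w) *m v.
    have -> : (D ^+ i - L ^+ i) *m L = D ^+ i *m D + D ^+ i *m w *m v - L ^+ i *m L.
      by rewrite mulmxBl {1}defL mulmxDr mulmxA.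
    by rewrite !exprSr -!mulmxE addrAC addrK.
  apply: addmx_sub; first exact: submx_trans (submxMr _ IHi) KL.
  by rewrite eqmx_opp (submx_trans (submxMl _ _)).
have LK : (L <= K)%MS.
  rewrite {1}defL addmx_sub //.
    by rewrite semiD (submx_trans (submxMl _ _)) // -[D ^+ _]subr0 -nilL.
  by rewrite (submx_trans (submxMl _ _)).
rewrite -ltnS ltn_neqAle (leq_trans (mxrankS LK) (rank_leq_row _)) andbT.
apply/eqP => rkL.
have freeK : row_free K.
  by rewrite /row_free eqn_leq rank_leq_row -{1}rkL mxrankS.
have /submxP[y defv] : (v <= L)%MS.
  have /eqmxP eqLK : (L == K)%MS.
    by rewrite -(geq_leqif (mxrank_leqif_eq LK)) rkL rank_leq_row.
  by rewrite eqLK.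
have : delta_mx (0 : 'I_1) ord_max *m K = 0 *m K.
  by rewrite -rowE rowK defv -mulmxA mulmxE -exprS nilL mulmx0 mul0mx.
move/(row_free_inj freeK)/rowP/(_ ord_max)/eqP.
by rewrite !mxE !eqxx oner_eq0.
Qed.

(** Matrices act on row vectors: row [p] is the image of a basis vector of degree [deg p]. *)
Definition raises (F : fieldType) (n : nat) (deg : 'I_n -> nat) (s : nat)
    (M : 'M[F]_n) : Prop :=
  forall p q, M p q != 0 -> (deg p + s <= deg q)%N.

Lemma raises_mul (F : fieldType) (n : nat) (deg : 'I_n -> nat) (s t : nat)
    (M N : 'M[F]_n) :
  raises deg s M -> raises deg t N -> raises deg (s + t) (M *m N).
Proof.
move=> rM rN p q; apply: contraNT => le_q; rewrite mxE big1 // => j _.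
apply: contraNeq le_q; rewrite mulf_eq0 negb_or => /andP[/rM le_pj /rN le_jq].
by rewrite addnA (leq_trans _ le_jq) // leq_add2r.
Qed.

Lemma raises_exp (F : fieldType) (n : nat) (deg : 'I_n.+1 -> nat) (s : nat)
    (M : 'M[F]_n.+1) :
  raises deg s M -> forall i, raises deg (i * s) (M ^+ i).
Proof.
move=> rM; elim=> [|i IHi] p q.
  by rewrite expr0 mxE mul0n addn0; case: (eqVneq p q) => [-> //|_]; rewrite eqxx.
by rewrite exprS mulSn; apply: raises_mul.
Qed.

Lemma raises_nilpotent (F : fieldType) (n k : nat) (deg : 'I_n.+1 -> nat)
    (M : 'M[F]_n.+1) :
  (forall p, deg p <= k)%N -> raises deg 1 M -> M ^+ k.+1 = 0.
Proof.
move=> le_deg /raises_exp/(_ k.+1) rM; apply/matrixP => p q; rewrite [RHS]mxE.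
apply/eqP; apply: contraTT isT => /rM; rewrite muln1 => le_pq.
by have := leq_trans le_pq (le_deg q); rewrite addnS ltnNge leq_addl.
Qed.

(** The geometric series in [- M] is finite by nilpotency. *)
Lemma raises_inv1D (F : fieldType) (n k : nat) (deg : 'I_n.+1 -> nat)
    (M : 'M[F]_n.+1) :
  (forall p, deg p <= k)%N -> raises deg 1 M ->
  exists2 G, raises deg 0 G & G *m (1%:M + M) = 1%:M.
Proof.
move=> le_deg rM.
have rN : raises deg 1 (- M) by move=> p q; rewrite mxE oppr_eq0; apply: rM.
exists (\sum_(i < k.+1) (- M) ^+ i).
  move=> p q; rewrite summxE; apply: contraNT => lt_qp; rewrite big1 // => i _.
  apply: contraNeq lt_qp => /(raises_exp rN); apply: leq_trans.
  by rewrite leq_add2l.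
apply: mulmx1C; have := subrX1 (- M) k.+1.
rewrite (raises_nilpotent le_deg rN) sub0r -opprD mulNr => /oppr_inj/esym.
by rewrite addrC.
Qed.

Lemma diag_conj_exp (F : fieldType) (n m : nat) (P : 'M[F]_n.+1) (d : 'rV[F]_n.+1) :
  P \in unitmx ->
  (invmx P *m diag_mx d *m P) ^+ m
    = invmx P *m diag_mx (\row_j d 0 j ^+ m) *m P.
Proof.
move=> uP; elim: m => [|m IHm].
  have -> : \row_j d 0 j ^+ 0 = const_mx 1 by apply/rowP => j; rewrite !mxE.
  by rewrite diag_const_mx mulmx1 mulVmx.
rewrite exprS IHm -mulmxE !mulmxA mulmxK //; congr (_ *m _).
rewrite -!mulmxA mulmx_diag; congr (_ *m diag_mx _).
by apply/rowP => j; rewrite !mxE exprS.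
Qed.

Lemma mul_diag_split (F : fieldType) (m n r d e : nat) (f : 'I_d -> 'I_r)
    (g : 'I_e -> 'I_r) (V : 'M[F]_(m, r)) (W : 'M[F]_(r, n)) (b : 'rV[F]_r) :
  injective f -> injective g -> (forall i j, f i != g j) -> (d + e)%N = r ->
  V *m diag_mx b *m W
    = colsub f V *m diag_mx (colsub f b) *m rowsub f W
    + colsub g V *m diag_mx (colsub g b) *m rowsub g W.
Proof.
move=> injf injg neq_fg def_r.
pose h (s : 'I_d + 'I_e) := match s with inl i => f i | inr j => g j end.
have injh : injective h.
  case=> [i|i] [j|j] /= e_ij.
  - by rewrite (injf _ _ e_ij).
  - by have := neq_fg i j; rewrite e_ij eqxx.
  - by have := neq_fg j i; rewrite e_ij eqxx.
  - by rewrite (injg _ _ e_ij).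
have bijh : bijective h.
  by apply: (inj_card_bij injh); rewrite card_sum !card_ord def_r.
apply/matrixP => p q; rewrite !mul_mx_diag !mxE (reindex h) /=; last exact: onW_bij.
rewrite big_sumType /=.
by congr (_ + _); apply: eq_bigr => i _; rewrite !mxE.
Qed.

Theorem low_rank_generators (F : fieldType) (d k : nat)
    (deg : 'I_d.+1 -> nat) (V : 'M[F]_(d.+1, d + d.+1)) (a : 'rV[F]_(d + d.+1))
    (U : 'M[F]_(d, d + d.+1)) (W : 'M[F]_(d + d.+1, d.+1)) :
  let N (x : 'rV[F]_d) := V *m diag_mx (x *m U) *m W in
  (forall p, deg p <= k)%N ->
  V *m diag_mx a *m W = 1%:M ->
  (forall x, raises deg 1 (N x)) ->
  (forall x, N x = 0 -> x = 0) ->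
  exists2 X : 'M[F]_d, X \in unitmx & forall j, (\rank (N (row j X)) <= k)%N.
Proof.
move=> N le_deg N1 raiseN injN.
have fullU : row_full U^T.
  rewrite /row_full mxrank_tr; apply: inj_row_free => x xU0.
  by apply: injN; rewrite /N xU0 linear0 mulmx0 mul0mx.
pose f := fullrankfun fullU : 'I_d -> 'I_(d + d.+1).
have injf : injective f by apply: fullrankfun_inj.
have unitUf : colsub f U \in unitmx.
  by rewrite -unitmx_tr trmx_mxsub fullrowsub_unit.
have cardC : #|~: [set f i | i : 'I_d]| = d.+1.
  by apply/eqP; rewrite -(eqn_add2l #|[set f i | i : 'I_d]|) cardsC card_ord
    card_imset ?card_ord.
pose g (j : 'I_d.+1) := enum_val (cast_ord (esym cardC) j).
have injg : injective g by apply: inj_comp enum_val_inj (cast_ord_inj (eq_n := _)).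
have neq_fg i j : f i != g j.
  have : g j \in ~: [set f i | i : 'I_d] by apply: enum_valP.
  by rewrite inE; apply: contraNneq => <-; apply: imset_f.
have split b := mul_diag_split V W b injf injg neq_fg erefl.
pose X := invmx (colsub f U).
(* This choice makes [a + x0 *m U] vanish on the indices [f]. *)
pose x0 := - (colsub f a *m X).
have [G raiseG GA] := raises_inv1D le_deg (raiseN x0).
pose b := colsub g (a + x0 *m U).
have af0 : colsub f (a + x0 *m U) = 0.
  by rewrite linearD /= -mulmx_colsub mulNmx -mulmxA mulVmx // mulmx1 subrr.
have unitA : colsub g V *m diag_mx b *m rowsub g W = 1%:M + N x0.
  by rewrite -N1 -mulmxDl -mulmxDr -linearD split af0 linear0 mulmx0 mul0mx add0r.
have [uVg ub uWg] : [/\ colsub g V \in unitmx, diag_mx b \in unitmx & rowsub g W \in unitmx].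
  have [_] := mulmx1_unit GA.
  by rewrite -unitA !unitmx_mul -andbA => /and3P.
exists X => [|j]; first by rewrite unitmx_inv.
have uG : G \in unitmx by have [] := mulmx1_unit GA.
set x := row j X.
have -> : \rank (N x) = \rank (G *m N x).
  by rewrite eqmxMfull // row_full_unit.
pose c := colsub g (x *m U).
pose e := \row_i (c 0 i / b 0 i).
have b_neq0 i : b 0 i != 0.
  move: ub; rewrite unitmxE det_diag unitfE => /prodf_neq0; exact.
have GVg : G *m colsub g V *m diag_mx b *m rowsub g W = 1%:M.
  by rewrite -!mulmxA (mulmxA (colsub g V)) unitA.
have defL : G *m N x = invmx (rowsub g W) *m diag_mx e *m rowsub g W
    + (G *m col (f j) V) *m row (f j) W.
  rewrite /N split mulmxDr addrC; congr (_ + _).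
    rewrite !mulmxA; congr (_ *m _).
    have -> : G *m colsub g V = invmx (rowsub g W) *m invmx (diag_mx b).
      apply: (canRL (mulmxK ub)); rewrite -[RHS]mul1mx.
      exact: (canRL (mulmxK uWg)).
    rewrite -mulmxA; congr (_ *m _); apply: (canLR (mulKmx ub)).
    rewrite mulmx_diag; congr (diag_mx _); apply/rowP => i.
    by rewrite [RHS]mxE [e 0 i]mxE mulrC divfK.
  rewrite -!mulmxA; congr (_ *m _).
  have -> : colsub f (x *m U) = delta_mx 0 j.
    by rewrite -mulmx_colsub /x -row_mul mulVmx // row1.
  apply/matrixP => p q; rewrite !mxE (bigD1 j) //= big1 ?addr0.
    by rewrite mul_diag_mx !mxE big_ord1 !mxE !eqxx mul1r.
  by move=> i /negPf neq_ij; rewrite mul_diag_mx !mxE eqxx neq_ij mul0r mulr0.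
(* Zero entries of [e] do no harm to [E], since their power [k.+1] vanishes. *)
apply: (rank_perturbation (E := invmx (rowsub g W) *m
    diag_mx (\row_i (e 0 i)^-1 ^+ k) *m rowsub g W)) defL _ _.
  by apply: raises_nilpotent le_deg _; rewrite -[1%N]add0n; apply: raises_mul.
rewrite diag_conj_exp // !mulmxA mulmxK //; congr (_ *m _).
rewrite -!mulmxA mulmx_diag; congr (_ *m diag_mx _); apply/rowP => i; rewrite !mxE.
set z := _ / _; have [->|z_neq0] := eqVneq z 0; first by rewrite exprS mul0r mulr0.
by rewrite exprS mulrCA -exprMn mulVf // expr1n mulr1.
Qed.

Lemma sum_of_simplesW (F : fieldType) (I J K : finType)
    (t : {ffun I * J * K -> F}) (r s : nat) :
  (r <= s)%N -> sum_of_simples t r -> sum_of_simples t s.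
Proof.
move=> /subnK <-; elim: (s - r)%N => [//|m IHm]; rewrite addSn => /IHm[f [simple_f ->]].
(* Pad with the zero tensor, which is simple. *)
exists (fun l => if unlift ord0 l is Some l' then f l' else 0); split=> [l|].
  case: unlift => [l'|]; first exact: simple_f.
  exists [ffun=> 0], [ffun=> 0], [ffun=> 0].
  by apply/ffunP => x; rewrite !ffunE !mul0r.
rewrite big_ord_recl unlift_none add0r.
by apply: eq_bigr => l _; rewrite liftK.
Qed.

(** * Lower bound for the cube of W *)

(* The number p = i + 2 j + 4 k, with i, j, k < 2, stands for the monomial
   e_p = x^i y^j z^k. *)
Definition weight (p : nat) : nat := p %/ 4 + p %/ 2 %% 2 + p %% 2.

Definition cube_bit (p q r : nat) : bool :=
  [&& p %/ 4 + q %/ 4 + r %/ 4 == 1,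
      p %/ 2 %% 2 + q %/ 2 %% 2 + r %/ 2 %% 2 == 1
    & p %% 2 + q %% 2 + r %% 2 == 1]%N.

Lemma tensor_cubeWE (F : fieldType) i1 i2 i3 j1 j2 j3 k1 k2 k3 :
  tensor_cube (W_tensor F) (i1, i2, i3, (j1, j2, j3), (k1, k2, k3)) =
  [&& i1 + j1 + k1 == 1, i2 + j2 + k2 == 1 & i3 + j3 + k3 == 1]%N%:R.
Proof.
have WE (i j k : 'I_2) : W_tensor F (i, j, k) = (i + j + k == 1)%N%:R.
  rewrite !ffunE /= -!natrM !mulnb -!natrD.
  by case: i j k => [[|[|//]] ?] [[|[|//]] ?] [[|[|//]] ?].
by rewrite 2!ffunE /= !WE -!natrM !mulnb andbA.
Qed.

Definition bits (p : nat) : 'I_2 * 'I_2 * 'I_2 :=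
  (inord (p %/ 4), inord (p %/ 2 %% 2), inord (p %% 2)).

Lemma tensor_cubeW_bits (F : fieldType) (p q r : nat) :
  (p < 8)%N -> (q < 8)%N -> (r < 8)%N ->
  tensor_cube (W_tensor F) (bits p, bits q, bits r) = (cube_bit p q r)%:R.
Proof.
have lt_div s : (s < 8)%N -> (s %/ 4 < 2)%N by rewrite ltn_divLR.
by move=> lt_p lt_q lt_r; rewrite tensor_cubeWE !inordK ?ltn_pmod ?lt_div.
Qed.

Lemma sum_indicator (F : fieldType) (n : nat) (x : 'I_n -> F) (c : pred 'I_n)
    (j : 'I_n) :
  c =1 pred1 j -> \sum_i x i * (c i)%:R = x j.
Proof.
move=> cE; rewrite (bigD1 j) //= cE /= eqxx mulr1 big1 ?addr0 // => i neq_ij.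
by rewrite cE /= (negPf neq_ij) mulr0.
Qed.

Lemma all_iotaP (n : nat) (P : pred nat) :
  reflect (forall i, (i < n)%N -> P i) (all P (iota 0 n)).
Proof.
by apply: (iffP allP) => allP i; have := allP i; rewrite mem_iota.
Qed.

(* [mul_bit i p q] is the coordinate on e_q of the product e_i * e_p, because
   e_(7 - q) is dual to e_q under the form taking (a, b) to the xyz
   coefficient of ab. *)
Definition mul_bit (i p q : nat) : bool := cube_bit i p (7 - q).

Lemma mul_bit0 (p q : nat) :
  (p < 8)%N -> (q < 8)%N -> mul_bit 0 p q = (p == q) /\ mul_bit p 0 q = (p == q).
Proof.
move=> lt_p lt_q; suff /andP[/eqP-> /eqP->] :
  (mul_bit 0 p q == (p == q)) && (mul_bit p 0 q == (p == q)) by [].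
move: q lt_q; apply/all_iotaP; move: p lt_p; apply/all_iotaP.
by vm_compute.
Qed.

Lemma mul_bit_weight (i p q : nat) : (i < 7)%N -> (p < 8)%N -> (q < 8)%N ->
  mul_bit i.+1 p q -> (weight p < weight q)%N.
Proof.
move=> lt_i lt_p lt_q; apply/implyP.
move: q lt_q; apply/all_iotaP; move: p lt_p; apply/all_iotaP.
move: i lt_i; apply/all_iotaP.
by vm_compute.
Qed.

(* The block with rows 1, y, z, yz and columns x, xy, xz, xyz is triangular, with
   the coefficient of the generator x = e_1 on the diagonal. *)
Lemma mul_bit_block (i p q : nat) : (i < 7)%N -> (p < 4)%N -> (q < 4)%N ->
  (q <= p)%N -> mul_bit i.+1 p.*2 q.*2.+1 = (i == 0) && (p == q).
Proof.
move=> lt_i lt_p lt_q le_qp; apply/eqP; move: le_qp; apply/implyP.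
move: q lt_q; apply/all_iotaP; move: p lt_p; apply/all_iotaP.
move: i lt_i; apply/all_iotaP.
by vm_compute.
Qed.

Lemma cubeW_rank_gt15 (F : fieldType) :
  ~ sum_of_simples (tensor_cube (W_tensor F)) 15.
Proof.
case=> s [simple_s defT].
have [u /boolp.choice[v /boolp.choice[w defs]]] := boolp.choice simple_s.
pose V := \matrix_(p < 8, l < 15) v l (bits p).
pose a := \row_(l < 15) u l (bits 0).
pose U := \matrix_(i < 7, l < 15) u l (bits i.+1).
pose W := \matrix_(l < 15, q < 8) w l (bits (7 - q)).
have tE (i p q : nat) : (i < 8)%N -> (p < 8)%N -> (q < 8)%N ->
    \sum_(l < 15) u l (bits i) * v l (bits p) * w l (bits (7 - q)) = (mul_bit i p q)%:R.
  move=> lt_i lt_p lt_q; rewrite -tensor_cubeW_bits ?ltnS ?leq_subr // defT sum_ffunE.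
  by apply: eq_bigr => l _; rewrite defs ffunE.
pose N (x : 'rV[F]_7) := V *m diag_mx (x *m U) *m W.
have NE x p q : N x p q = \sum_i x 0 i * (mul_bit i.+1 p q)%:R.
  rewrite mxE; under eq_bigr => l _.
    rewrite mul_mx_diag !mxE mulr_sumr mulr_suml.
    over.
  rewrite exchange_big; apply: eq_bigr => i _ /=.
  rewrite -(tE i.+1 p q (ltn_ord i)) // mulr_sumr; apply: eq_bigr => l _; rewrite !mxE.
  by rewrite (mulrCA (v l _)) (mulrC (v l _)) !mulrA.
have N1 : V *m diag_mx a *m W = 1%:M.
  apply/matrixP => p q; rewrite !mxE -val_eqE /= -(mul_bit0 _ _).1 // -(tE 0 p q) //.
  by apply: eq_bigr => l _; rewrite mul_mx_diag !mxE [v l _ * _]mulrC.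
have raiseN x : raises (fun p : 'I_8 => weight p) 1 (N x).
  move=> p q; rewrite NE; apply: contraNT; rewrite addn1 => le_qp.
  rewrite big1 // => i _; case: (boolP (mul_bit _ _ _)); rewrite ?mulr0 //.
  by move/mul_bit_weight => lt_pq; rewrite lt_pq in le_qp.
have injN x : N x = 0 -> x = 0.
  move=> Nx0; apply/rowP => j; have := NE x 0 (lift 0 j).
  rewrite Nx0 !mxE => ->; apply/esym/(@sum_indicator _ _ (x 0)) => i.
  by rewrite (@mul_bit0 i.+1 (lift 0 j) (ltn_ord i) (ltn_ord _)).2 lift0 eqSS.
have le_weight (p : 'I_8) : (weight p <= 3)%N.
  by move: (nat_of_ord p) (ltn_ord p); apply/all_iotaP.
have [X uX rkX] := low_rank_generators le_weight N1 raiseN injN.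
(* Column 0 of the invertible [X] holds the coefficients of the generator x. *)
have [j Xj0] : exists j, X j 0 != 0.
  apply/existsP; apply: contraT; rewrite negb_exists => /forallP X0.
  have /eqP : delta_mx 0 0 = 0 :> 'cV[F]_7.
    rewrite -(mulKmx uX (delta_mx 0 0)) -colE.
    suff -> : col 0 X = 0 by rewrite mulmx0.
    by apply/colP => i; rewrite !mxE; apply/eqP; rewrite -[_ == _]negbK.
  by move/eqP/colP/(_ 0)/eqP; rewrite !mxE eqxx oner_eq0.
pose x := row j X.
pose f (p : 'I_4) : 'I_8 := inord p.*2.
pose g (q : 'I_4) : 'I_8 := inord q.*2.+1.
have blockE (p q : 'I_4) : (q <= p)%N -> mxsub f g (N x) p q = x 0 0 *+ (p == q).
  move=> le_qp; rewrite mxE NE !inordK; last 2 first.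
  - exact: etrans (ltn_Sdouble q 4) (ltn_ord q).
  - exact: etrans (ltn_double p 4) (ltn_ord p).
  rewrite -(@sum_indicator _ _ (fun i => x 0 i *+ (p == q)) (pred1 0)) //.
  apply: eq_bigr => i _; rewrite mul_bit_block //.
  by rewrite -val_eqE /=; case: (val p == q); rewrite ?andbT // andbF mulr0 mul0r.
have det_block : \det (mxsub f g (N x)) = x 0 0 ^+ 4.
  (* The block is upper triangular, while [det_trig] takes lower triangular matrices. *)
  rewrite -det_tr det_trig; last first.
    apply/is_trig_mxP => p q lt_pq; rewrite mxE blockE ?(ltnW lt_pq) //.
    by rewrite -val_eqE /= gtn_eqF.
  under eq_bigr => p _ do rewrite mxE blockE // eqxx.
  by rewrite prodr_const card_ord.
have : (4 <= \rank (N x))%N.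
  have /mxrank_unit {1}<- : mxsub f g (N x) \in unitmx.
    by rewrite unitmxE det_block unitfE expf_neq0 // mxE.
  rewrite -[N x]mulmx1 mxsub_mul (leq_trans (mxrankM_maxl _ _)) // mulmx1.
  exact: mxrankS (rowsub_sub _ _).
by rewrite leqNgt ltnS rkX.
Qed.

(** * Upper bound by sixteen weighted cubes *)

Definition code (b : 'I_2 * 'I_2 * 'I_2) : nat := b.1.1 * 4 + b.1.2 * 2 + b.2.

Lemma code_lt (b : 'I_2 * 'I_2 * 'I_2) : (code b < 8)%N.
Proof. by case: b => [[[[|[|//]] ?] [[|[|//]] ?]] [[|[|//]] ?]]. Qed.

Lemma codeK : cancel code bits.
Proof.
by case=> [[[[|[|//]] ?] [[|[|//]] ?]] [[|[|//]] ?]];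
  congr (_, _, _); apply: val_inj; rewrite /= inordK.
Qed.

(* The form l is given by the node l / 4 and the signs (-1)^l0, (-1)^l1,
   (-1)^(l0 + l1), where l0 and l1 are the low binary digits of l. Its coordinate
   on e_p depends on p through the weight and a product of signs; the sign of
   a_j also fits b_j because the three signs multiply to 1. The node weights
   1 / (4 Q'(tau)) are 8, -9, 2, -1 over 288. *)
Definition cube_coef (l : nat) : int := nth 0 [:: 8; -9; 2; -1] (l %/ 4).

Definition cube_form (l p : nat) : int :=
  (-1) ^+ odd (l %% 2 * (p %/ 4) + l %/ 2 %% 2 * (p %/ 2 %% 2)
               + (l %% 2 + l %/ 2 %% 2) * (p %% 2))
  * nth 0 (nth [::] [:: [:: -6;  0; 1; -1];
                        [:: -6;  1; 1; -1];
                        [::  0;  3; 1; -1];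
                        [::  6; -3; 1; -1]] (l %/ 4)) (weight p).

Lemma sum_cube_form (p q r : nat) : (p < 8)%N -> (q < 8)%N -> (r < 8)%N ->
  \sum_(l < 16) cube_coef l * cube_form l p * cube_form l q * cube_form l r
    = (cube_bit p q r)%:R * 288.
Proof.
rewrite -(big_mkord xpredT (fun l => cube_coef l * cube_form l p * cube_form l q
  * cube_form l r)) unlock => lt_p lt_q lt_r; apply/eqP.
move: r lt_r; apply/all_iotaP; move: q lt_q; apply/all_iotaP.
move: p lt_p; apply/all_iotaP.
by vm_compute.
Qed.

Lemma cubeW_rank_le16 (F : numFieldType) :
  sum_of_simples (tensor_cube (W_tensor F)) 16.
Proof.
pose c (l : 'I_16) (b : 'I_2 * 'I_2 * 'I_2) : F := (cube_form l (code b))%:~R.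
(* The weight of each cube goes into its first factor. *)
exists (fun l : 'I_16 => tensor_prod [ffun b => (cube_coef l)%:~R / 288 * c l b]
                   [ffun b => c l b] [ffun b => c l b]).
split=> [l|]; first by do 3!eexists; reflexivity.
apply/ffunP => x; rewrite sum_ffunE.
case: x => [[p q] r]; rewrite -[LHS](mulfK (_ : 288 != 0)) ?pnatr_eq0 //.
have /(congr1 (fun z : int => z%:~R : F)) :=
  sum_cube_form (code_lt p) (code_lt q) (code_lt r).
rewrite rmorphM /= !rmorph_nat -tensor_cubeW_bits ?code_lt // !codeK => <-.
rewrite rmorph_sum mulr_suml; apply: eq_bigr => l _.
by rewrite !ffunE /c 3!rmorphM /=; ring.
Qed.

Local Close Scope ring_scope.

Theorem theorem12 (R : realType) :
  tensor_rank (tensor_cube (W_tensor R[i])) = 16.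
Proof.
rewrite /tensor_rank; case: ex_minnP => m /asboolP rank_m min_m.
apply/eqP; rewrite eqn_leq min_m; last exact/asboolP/cubeW_rank_le16.
rewrite ltnNge; apply/negP => le_m15.
exact: cubeW_rank_gt15 (sum_of_simplesW le_m15 rank_m).
Qed.
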